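(* Let $\mathbb F$ be an algebraically closed field, and let $\mathbb A$ be a finite-dimensional non-degenerate evolution algebra over $\mathbb F$ with $\Delta$-trace $\Delta(\mathbb A)=(\overline{\mathbb A_1},\dots,\overline{\mathbb A_r})$. Then there exists a natural basis $\mathbf B$ of $\mathbb A$ such that the structure matrix of $\mathbb A$ with respect to $\mathbf B$ has the following diagonal blocks: $$\mathbf M_{\mathbf B}(\mathbb A)=\begin{pmatrix}\overline{\mathbb A_1}&*&*&*\\ *&\overline{\mathbb A_2}&*&*\\ *&*&\ddots&*\\ *&*&*&\overline{\mathbb A_r}\end{pmatrix},$$ where the $i$-th diagonal block is the structure matrix of $\overline{\mathbb A_i}$ in its defining basis. Also, $\mathbf M_{\mathbf B}(\mathbb A)$ has the column form $$\mathbf M_{\mathbf B}(\mathbb A)=(v_1\ldots v_1\,|\,v_2\ldots v_2\,|\,\ldots\,|\,v_r\ldots v_r),$$ that is, within the $i$-th block of columns (of size $\dim\overline{\mathbb A_i}$) all columns are equal to one vector $v_i$.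
   Context: Algebras are finite-dimensional over $\mathbb F$ with a bilinear product, not necessarily associative. An evolution algebra is an algebra having a basis $\mathbf B=\{e_1,\dots,e_n\}$ (a natural basis) with $e_ie_j=0$ for $i\ne j$; its structure matrix relative to $\mathbf B$ is $\mathbf M_{\mathbf B}(\mathbb A)=(w_{ki})$ where $e_i^2=\sum_k w_{ki}e_k$ (column $i$ gives $e_i^2$). It is non-degenerate if $\mathrm{Ann}(\mathbb A)=\{x: x\mathbb A+\mathbb Ax=0\}$ is zero. An extending evolution subspace is a linear subspace spanned by a subset of some natural basis of $\mathbb A$. For subspaces $X,Y$, $XY$ denotes the linear span of all products, and $X^2=XX$. Every non-degenerate evolution algebra has a unique (up to order) decomposition $\mathbb A=\mathbb E_1\oplus\dots\oplus\mathbb E_r$, where the $\mathbb E_i$ are extending evolution subspaces with $\dim(\mathbb E_i^2)=1$, and $\mathbb E_i\mathbb E_j=0$, $\dim(\mathbb E_i^2+\mathbb E_j^2)=2$ for $i\neq j$. For each $i$, let $\pi_{\mathbb E_i}:\mathbb A\to\mathbb E_i$ be the projection along the other summands, and let $\mathbb A_i$ be the algebra on the vector space $\mathbb E_i$ with product $x\cdot_{\mathbb A_i}y=\pi_{\mathbb E_i}(xy)$. It is either an algebra with zero product or a non-degenerate evolution algebra with $\dim(\mathbb A_i^2)=1$. Consider the following algebras with basis $e_1,\dots,e_m$ (and $e_ie_j=0$ for $i\ne j$): $\mathbf O_m$ (zero product); $\mathbf E_m$: $e_1^2=\dots=e_m^2=e_1$; and, for $m\ge2$, $\mathbf I_m$: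 $e_1^2=\dots=e_m^2=e_1+\mathbf i e_2$, where $\mathbf i\in\mathbb F$ is a fixed element with $\mathbf i^2=-1$. With $m=\dim\mathbb E_i$, put $\overline{\mathbb A_i}=\mathbf O_m$ if $\mathbb A_i\cong\mathbf O_m$, $\overline{\mathbb A_i}=\mathbf E_m$ if $\mathbb A_i\cong\mathbf E_m$, and $\overline{\mathbb A_i}=\mathbf I_m$ if $\mathbb A_i\cong\mathbf I_m$. The $\Delta$-trace is $\Delta(\mathbb A)=(\overline{\mathbb A_1},\dots,\overline{\mathbb A_r})$, with the $\mathbb A_i$ ordered by non-increasing dimension and, in equal dimension $m$, copies of $\mathbf O_m$ first, then $\mathbf E_m$, then $\mathbf I_m$. *)

(* Defs.v *)
From HB Require Import structures.
From mathcomp Require Import all_boot all_order all_algebra.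
From mathcomp Require Import sesquilinear.

Set Implicit Arguments.
Unset Strict Implicit.
Unset Printing Implicit Defensive.

Import GRing.Theory.
Local Open Scope ring_scope.

(* An algebra is a [vectType] together with a product; bilinearity of the
   product is only required where it matters. *)

Section Algebras.
Variables (F : fieldType) (A : vectType F).

(* A basis is duplicate-free, so distinct members are distinct indices. *)
Definition natural_basis (mul : A -> A -> A) (B : seq A) : Prop :=
  basis_of {:A} B /\
  (forall x y, x \in B -> y \in B -> x != y -> mul x y = 0).

Definition evolution_algebra (mul : A -> A -> A) : Prop :=
  exists B : seq A, natural_basis mul B.

Definition structure_mx (mul : A -> A -> A) (n : nat) (B : n.-tuple A) :
    'M[F]_n :=
  \matrix_(k, i) coord B k (mul (tnth B i) (tnth B i)).

Definition in_annihilator (mul : A -> A -> A) (x : A) : Prop :=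
  forall y, mul x y = 0 /\ mul y x = 0.

Definition nondegenerate_algebra (mul : A -> A -> A) : Prop :=
  forall x, in_annihilator mul x -> x = 0.

Definition extending_evolution_subspace (mul : A -> A -> A) (U : {vspace A}) :
    Prop :=
  exists (B S : seq A),
    [/\ natural_basis mul B, {subset S <= B} & U = <<S>>%VS].

(* Product of subspaces, as in falgebra.v but for an arbitrary product; for a
   bilinear [mul] this is the span of all products, see [prodsp_subP]. *)
Definition prodsp (mul : A -> A -> A) (U V : {vspace A}) : {vspace A} :=
  <<[seq mul x y | x <- vbasis U, y <- vbasis V]>>%VS.

Lemma prodsp_subP (mul : {bilinear A -> A -> A}) (U V W : {vspace A}) :
  (prodsp mul U V <= W)%VS <->
  (forall x y, x \in U -> y \in V -> mul x y \in W).
Proof.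
split=> [/span_subvP sW x y Ux Vy | sW].
  rewrite (coord_vbasis Ux) (coord_vbasis Vy) linear_sumlz /=.
  apply: memv_suml => i _; rewrite linear_sumr /=.
  apply: memv_suml => j _; rewrite linearZl_LR linearZr_LR /= !memvZ //.
  apply: sW; apply/allpairsP.
  by exists ((vbasis U)`_i, (vbasis V)`_j); rewrite !memt_nth.
apply/span_subvP=> _ /allpairsP[[x y] /= [Ux Vy ->]].
by apply: sW; apply: vbasis_mem.
Qed.

(* The decomposition of A into extending evolution subspaces with pairwise
   distinct one-dimensional squares; it is unique up to reindexing when A is a
   non-degenerate evolution algebra. *)
Definition evo_decomposition (mul : A -> A -> A) (r : nat)
    (E : 'I_r -> {vspace A}) : Prop :=
  [/\ directv (\sum_(i < r) E i)%VS /\ (\sum_(i < r) E i)%VS = {:A}%VS,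
      forall i, extending_evolution_subspace mul (E i),
      forall i, \dim (prodsp mul (E i) (E i)) = 1%N
    & forall i j, i != j ->
        prodsp mul (E i) (E j) = 0%VS /\
        \dim (prodsp mul (E i) (E i) + prodsp mul (E j) (E j)) = 2 ].

Definition summand_proj (r : nat) (E : 'I_r -> {vspace A}) (i : 'I_r) :
    'End(A) :=
  daddv_pi (E i) (\sum_(j < r | j != i) E j)%VS.

Definition summand_mul (mul : A -> A -> A) (r : nat) (E : 'I_r -> {vspace A})
    (i : 'I_r) (x y : subvs_of (E i)) : subvs_of (E i) :=
  vsproj (E i) (summand_proj E i (mul (vsval x) (vsval y))).

End Algebras.

Definition alg_iso (F : fieldType) (U V : vectType F)
    (mulU : U -> U -> U) (mulV : V -> V -> V) : Prop :=
  exists f : {linear U -> V},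
    bijective f /\ (forall x y, f (mulU x y) = mulV (f x) (f y)).

(* O_m, E_m, I_m are encoded by their type and dimension. *)
Inductive model_type := TypeO | TypeE | TypeI.

Record model := Model { mtype : model_type; mdim : nat }.

Definition model_rank (t : model_type) : nat :=
  match t with TypeO => 0%N | TypeE => 1%N | TypeI => 2%N end.

(* I_m exists only for m >= 2. *)
Definition model_wf (D : model) : Prop :=
  mtype D = TypeI -> (2 <= mdim D)%N.

Section Models.
Variables (F : fieldType) (im : F).

Definition std_basis (m : nat) : m.-tuple 'cV[F]_m :=
  [tuple delta_mx j 0 | j < m].

(* The common square of the basis vectors: 0, e_1 or e_1 + im e_2, where e_1
   and e_2 are the basis vectors of indices 0 and 1. *)
Definition model_sq (D : model) : 'cV[F]_(mdim D) :=
  match mtype D with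
  | TypeO => 0
  | TypeE => \col_k (k == 0 :> nat)%:R
  | TypeI => \col_k ((k == 0 :> nat)%:R + im * (k == 1 :> nat)%:R)
  end.

Definition model_mul (D : model) (x y : 'cV[F]_(mdim D)) : 'cV[F]_(mdim D) :=
  \sum_(j < mdim D) (x j 0 * y j 0) *: model_sq D.

Lemma std_basisP (m : nat) : basis_of {:'cV[F]_m} (std_basis m).
Proof.
have sp : <<std_basis m>>%VS = fullv.
  apply/eqP; rewrite eqEsubv subvf; apply/subvP=> v _.
  rewrite [v]matrix_sum_delta; apply: memv_suml => i _.
  apply: memv_suml => j _; rewrite ord1 memvZ ?memv_span //.
  by apply/mapP; exists i; rewrite ?mem_enum.
by rewrite basisEdim sp subvv size_tuple dimvf /dim /= muln1 leqnn.
Qed.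

Lemma structure_mx_model (D : model) :
  structure_mx (@model_mul D) (std_basis (mdim D)) =
  \matrix_(k, i) model_sq D k 0.
Proof.
set m := mdim D.
have coordE (v : 'cV[F]_m) k : coord (std_basis m) k v = v k 0.
  have /andP[_ fr] := std_basisP m.
  rewrite [in LHS](_ : v = \sum_i v i 0 *: (std_basis m)`_i).
    by rewrite coord_sum_free.
  rewrite [LHS]matrix_sum_delta; apply: eq_bigr => i _.
  by rewrite big_ord1 -tnth_nth tnth_mktuple.
apply/matrixP=> k i; rewrite !mxE coordE tnth_mktuple /model_mul.
rewrite (bigD1 i) //= big1 ?addr0 => [|j ji].
  by rewrite [_ i 0]mxE !eqxx mulr1 scale1r.
by rewrite [_ j 0]mxE (negbTE ji) mul0r scale0r.
Qed.

End Models.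

(* "D is the Delta-trace of A", as a relation: in characteristic 2 a summand
   algebra need not be isomorphic to any of O_m, E_m, I_m, and then A has no
   Delta-trace. *)
Definition Delta_trace (F : fieldType) (im : F) (A : vectType F)
    (mul : A -> A -> A) (r : nat) (D : 'I_r -> model) : Prop :=
  exists E : 'I_r -> {vspace A},
    [/\ evo_decomposition mul E,
        forall i, mdim (D i) = \dim (E i) /\ model_wf (D i),
        forall i, alg_iso (@summand_mul F A mul r E i) (@model_mul F im (D i))
      & forall i j : 'I_r, (i <= j)%N ->
          (mdim (D j) < mdim (D i))%N \/
          (mdim (D i) = mdim (D j) /\
           (model_rank (mtype (D i)) <= model_rank (mtype (D j)))%N)].

(* Main.v *)
(* The product of E_i is b_i(x, y) v for a bilinear form b_i and a vector v
   spanning E_i^2.  If the model of A_i has a non-zero product, then pi_i is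
   injective on <v>, so the preimage of the standard basis of the model is
   already b_i-orthogonal with a common square.  Otherwise pi_i kills v, and any
   natural basis of E_i only has to be rescaled by square roots so that all
   squares equal v.  Concatenating these bases of the E_i gives B. *)

Require Import Defs.
From mathcomp Require Import all_boot all_order all_algebra.
From mathcomp Require Import sesquilinear.

Set Implicit Arguments.
Unset Strict Implicit.
Unset Printing Implicit Defensive.

Import GRing.Theory.
Local Open Scope ring_scope.

Lemma exists_sqrt (F : closedFieldType) (a : F) : exists b : F, b ^+ 2 = a.
Proof.
(* The coefficients encode the monic equation [x ^+ 2 = a + 0 * x]. *)
have [b bE] := @solve_monicpoly F 2 (fun i => if i is 0%N then a else 0) isT.
by exists b; rewrite bE big_ord_recl big_ord1 mul0r addr0 mulr1.
Qed.

Lemma dimv1_line (F : fieldType) (A : vectType F) (U : {vspace A}) :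
  \dim U = 1%N -> exists v, U = <[v]>%VS.
Proof.
move=> dimU; exists (vpick U); apply/esym/eqP.
by rewrite eqEdim -memvE memv_pick dim_vline vpick0 -dimv_eq0 dimU.
Qed.

(** A natural basis vector with zero square would annihilate the whole basis, hence all of [A] by
    bilinearity, and so would be zero. *)
Lemma natural_basis_sq_neq0 (F : fieldType) (A : vectType F)
    (mul : {bilinear A -> A -> A}) (B : seq A) (s : A) :
  nondegenerate_algebra mul -> natural_basis mul B -> s \in B ->
  mul s s != 0.
Proof.
move=> hnd [bB natB] sB; apply/eqP => ss0.
have s_ann x : x \in B -> mul s x = 0 /\ mul x s = 0.
  move=> xB; have [<-|sx] := eqVneq s x; first by [].
  by split; apply: natB; rewrite // eq_sym.
have /hnd s0 : in_annihilator mul s.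
  move=> y; have /(coord_span (X := in_tuple B)) -> : y \in <<B>>%VS.
    by rewrite (span_basis bB) memvf.
  split.
    rewrite linear_sumr /= big1 // => i _.
    by rewrite linearZr_LR /= (s_ann _ _).1 ?scaler0 // mem_nth.
  rewrite linear_sumlz /= big1 // => i _.
  by rewrite linearZl_LR /= (s_ann _ _).2 ?scaler0 // mem_nth.
by move: (free_not0 (basis_free bB) sB); rewrite s0 eqxx.
Qed.

(** The spanning sequence in the definition may have repetitions; filtering the natural basis by
    membership in it keeps the span and gives a free family. *)
Lemma extending_evolution_subspace_basis (F : fieldType) (A : vectType F)
    (mul : A -> A -> A) (U : {vspace A}) :
  extending_evolution_subspace mul U ->
  exists B S : seq A,
    [/\ natural_basis mul B, {subset S <= B} & basis_of U S].
Proof.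
case=> [B [S [natB sSB ->]]]; exists B, [seq x <- B | x \in S]; split=> //.
  by move=> x; rewrite mem_filter => /andP[].
have eqS : [seq x <- B | x \in S] =i S.
  by move=> x; rewrite mem_filter; case: (boolP (x \in S)) => // /sSB ->.
by rewrite /basis_of (eq_span eqS) eqxx filter_free // (basis_free natB.1).
Qed.

Lemma model_mul_std (F : fieldType) (im : F) (D : model) (i j : 'I_(mdim D)) :
  model_mul im (delta_mx i 0) (delta_mx j 0) = (i == j)%:R *: model_sq im D.
Proof.
rewrite /model_mul (bigD1 i) //= big1 ?addr0 => [|k /negbTE ki].
  by rewrite !mxE !eqxx !andbT mul1r.
by rewrite mxE ki mul0r scale0r.
Qed.

(** The isomorphism controls products only after projection to [E i]. Since they all lie on the line
    of [v], where the projection is injective, the relations lift to [mul] itself. *)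
Lemma model_square_basis (F : fieldType) (im : F) (A : vectType F)
    (mul : {bilinear A -> A -> A}) (r : nat) (E : 'I_r -> {vspace A})
    (i : 'I_r) (D : model) (v : A) :
  (forall x y, x \in E i -> y \in E i -> mul x y \in <[v]>%VS) ->
  alg_iso (@summand_mul F A mul r E i) (@model_mul F im D) ->
  model_sq im D != 0 ->
  exists (e : 'I_(mdim D) -> A) (w : A),
    [/\ forall j, e j \in E i,
        (E i <= <<codom e>>)%VS,
        forall j k, mul (e j) (e k) = (j == k)%:R *: w
      & summand_proj E i w = \sum_k model_sq im D k 0 *: e k].
Proof.
move=> sqv [f [[g fK gK] fM]] sq0.
pose e (j : 'I_(mdim D)) := vsval (g (delta_mx j 0)).
have eE j : e j \in E i by exact: subvsP.
have f_comb (c : 'cV_(mdim D)) : f (\sum_k c k 0 *: g (delta_mx k 0)) = c.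
  rewrite linear_sum /= [RHS]matrix_sum_delta; apply: eq_bigr => k _.
  by rewrite big_ord1 linearZ /= gK.
have g_comb (c : 'cV_(mdim D)) : vsval (g c) = \sum_k c k 0 *: e k.
  rewrite -{1}[c]f_comb fK linear_sum /=; exact: eq_bigr.
have pi_mul j k : summand_proj E i (mul (e j) (e k)) =
    (j == k)%:R *: vsval (g (model_sq im D)).
  rewrite -[LHS](vsprojK (U := E i)) ?memv_pi // -[vsproj _ _]fK.
  have -> : vsproj (E i) (summand_proj E i (mul (e j) (e k))) =
    summand_mul mul (g (delta_mx j 0)) (g (delta_mx k 0)) by [].
  rewrite fM !gK model_mul_std; case: eqP => _; first by rewrite !scale1r.
  rewrite !scale0r; have <- : f 0 = 0 by rewrite linear0.
  by rewrite fK linear0.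
have gsq0 : vsval (g (model_sq im D)) != 0.
  apply: contra_neq sq0 => g0.
  by rewrite -[LHS]gK -[g _]vsvalK g0 !linear0.
(* A non-zero column has at least one entry; the square of [e k0] will serve as [w]. *)
have [k0 _] : exists k0 : 'I_(mdim D), true.
  case: (pickP (fun k => model_sq im D k 0 != 0)) => [k _|all0].
    by exists k.
  case/eqP: sq0; apply/colP => k; rewrite mxE; apply/eqP.
  by move: (all0 k) => /negbFE.
(* If the projection killed [v], it would kill the square of [e k0], whose projection is the
   non-zero vector [g (model_sq im D)]. *)
have pi_inj x y : x \in <[v]>%VS -> y \in <[v]>%VS ->
    summand_proj E i x = summand_proj E i y -> x = y.
  move=> xv yv pixy; apply/eqP; rewrite -subr_eq0; apply/eqP.
  have /vlineP[c cE] : x - y \in <[v]>%VS by rewrite memvB.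
  have /vlineP[d dE] := sqv _ _ (eE k0) (eE k0).
  have /eqP : c *: summand_proj E i v = 0.
    by rewrite -linearZ /= -cE linearB /= pixy subrr.
  rewrite scaler_eq0 => /orP[/eqP c0|/eqP v0]; first by rewrite cE c0 scale0r.
  case/eqP: gsq0; rewrite -[LHS]scale1r -[1]/(true%:R) -(eqxx k0) -pi_mul.
  by rewrite dE linearZ /= v0 scaler0.
exists e, (mul (e k0) (e k0)); split=> //.
- apply/subvP => x xE; rewrite -(vsprojK xE) -[vsproj _ _]fK g_comb.
  apply: memv_suml => k _; rewrite memvZ ?memv_span //; exact: codom_f.
- move=> j k; apply: pi_inj; rewrite ?memvZ ?sqv //.
  by rewrite linearZ /= !pi_mul eqxx scale1r.
- by rewrite pi_mul eqxx scale1r g_comb.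
Qed.

(** When the summand algebra has zero product, the isomorphism gives no orthogonality in [A], so the
    vectors come from a natural basis of [A]. Non-degeneracy makes the scalars [b j] non-zero, so
    that one can divide by them. *)
Lemma summand_mul0_square_basis (F : closedFieldType) (A : vectType F)
    (mul : {bilinear A -> A -> A}) (r : nat) (E : 'I_r -> {vspace A})
    (i : 'I_r) (v : A) :
  nondegenerate_algebra mul -> extending_evolution_subspace mul (E i) ->
  prodsp mul (E i) (E i) = <[v]>%VS ->
  (forall x y, @summand_mul F A mul r E i x y = 0) ->
  exists e : 'I_(\dim (E i)) -> A,
    [/\ forall j, e j \in E i,
        (E i <= <<codom e>>)%VS,
        forall j k, mul (e j) (e k) = (j == k)%:R *: v
      & summand_proj E i v = 0].
Proof.
move=> hnd /extending_evolution_subspace_basis[B [S [natB sSB bS]]] sqv mul0.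
have sS : size S = \dim (E i) by rewrite (size_basis (X := in_tuple S)).
have SE (j : 'I_(\dim (E i))) : S`_j \in S by rewrite mem_nth ?sS.
have inE : forall x y, x \in E i -> y \in E i -> mul x y \in <[v]>%VS.
  by apply/prodsp_subP; rewrite sqv.
have scal (j : 'I_(\dim (E i))) :
    exists b : F, b != 0 /\ mul S`_j S`_j = b ^+ 2 *: v.
  have /vlineP[a aE] := inE _ _ (basis_mem bS (SE j)) (basis_mem bS (SE j)).
  have [b bE] := exists_sqrt a; exists b; split; last by rewrite bE.
  have := natural_basis_sq_neq0 hnd natB (sSB _ (SE j)).
  by apply: contra_neq => b0; rewrite aE -bE b0 expr0n scale0r.
have [b bP] := fin_all_exists scal.
exists (fun j => (b j)^-1 *: S`_j); split.
- by move=> j; rewrite memvZ // (basis_mem bS).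
- rewrite -[X in (X <= _)%VS](span_basis bS); apply/span_subvP => x xS.
  have xlt : (index x S < \dim (E i))%N by rewrite -sS index_mem.
  have -> : x = b (Ordinal xlt) *: ((b (Ordinal xlt))^-1 *: S`_(Ordinal xlt)).
    by rewrite scalerA divff ?scale1r ?nth_index // (bP _).1.
  rewrite memvZ // memv_span //.
  exact: (codom_f (fun j : 'I_(\dim (E i)) => (b j)^-1 *: S`_j)).
- move=> j k; rewrite linearZl_LR linearZr_LR /=.
  have [<-|jk] := eqVneq j k.
    have bj0 := (bP j).1.
    by rewrite (bP j).2 !scalerA expr2 mulrACA mulVf // mulr1.
  rewrite scale0r natB.2 ?scaler0 ?sSB //.
  by rewrite nth_uniq ?sS // (free_uniq (basis_free bS)).
(* The products of [E i] all project to zero, and they span the line of [v]. *)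
- have sub : (<[v]> <= lker (summand_proj E i))%VS.
    rewrite -sqv; apply/prodsp_subP => x y xE yE; rewrite memv_ker.
    have := mul0 (vsproj (E i) x) (vsproj (E i) y).
    rewrite /summand_mul !vsprojK // => pxy0.
    by rewrite -[X in X == 0](vsprojK (U := E i)) ?memv_pi // pxy0 linear0.
  by apply/eqP; rewrite -memv_ker; apply: (subvP sub); rewrite memv_line.
Qed.

(** Both cases in one form: the last clause fixes the component of the common square [w] in [E i],
    which yields the diagonal block, and leaves its other components arbitrary. *)
Lemma summand_square_basis (F : closedFieldType) (im : F) (A : vectType F)
    (mul : {bilinear A -> A -> A}) (r : nat) (E : 'I_r -> {vspace A})
    (i : 'I_r) (D : model) :
  nondegenerate_algebra mul -> extending_evolution_subspace mul (E i) ->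
  \dim (prodsp mul (E i) (E i)) = 1%N ->
  mdim D = \dim (E i) ->
  alg_iso (@summand_mul F A mul r E i) (@model_mul F im D) ->
  exists (e : 'I_(mdim D) -> A) (w : A),
    [/\ forall j, e j \in E i,
        (E i <= <<codom e>>)%VS,
        forall j k, mul (e j) (e k) = (j == k)%:R *: w
      & summand_proj E i w = \sum_k model_sq im D k 0 *: e k].
Proof.
move=> hnd extE /dimv1_line[v sqv] dimD isoD.
(* The split is on the common square of the model rather than on its type; if it is zero, the
   isomorphism forces [summand_mul] to vanish. *)
have [sq0|] := eqVneq (model_sq im D) 0; last first.
  by apply: model_square_basis isoD; apply/prodsp_subP; rewrite sqv.
have mul0 (x y : subvs_of (E i)) : summand_mul mul x y = 0.
  have [f [[g fK _] fM]] := isoD; rewrite -[LHS]fK fM.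
  rewrite /model_mul sq0 big1 => [|j _]; last by rewrite scaler0.
  by rewrite -[RHS]fK linear0.
have [] := summand_mul0_square_basis hnd extE sqv mul0.
rewrite -dimD => e [eE sE eM pv]; exists e, v; split=> //.
by rewrite pv big1 // => k _; rewrite sq0 mxE scale0r.
Qed.

(** In a basis adapted to the direct sum, the projection fixes the vectors of block [i] and kills
    the others, so it preserves the coordinates of block [i]. *)
Lemma coord_summand_proj (F : fieldType) (A : vectType F) (r : nat)
    (E : 'I_r -> {vspace A}) (d : 'I_r -> nat)
    (B : (\sum_(i < r) d i).-tuple A) (i : 'I_r) (k : 'I_(d i)) (w : A) :
  directv (\sum_(i < r) E i)%VS -> basis_of {:A} B ->
  (forall i (j : 'I_(d i)), tnth B (tagnat.Rank i j) \in E i) ->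
  coord B (tagnat.Rank i k) w = coord B (tagnat.Rank i k) (summand_proj E i w).
Proof.
move=> dirE bB BE; have freeB := basis_free bB.
have disj : (E i :&: (\sum_(j < r | j != i) E j) = 0)%VS.
  exact: (directv_sumP dirE).
have nthB (l : 'I_(\sum_(i < r) d i)) : B`_l = tnth B l by rewrite (tnth_nth 0).
have proj_in (l : 'I_(\sum_(i < r) d i)) :
    tagnat.sig1 l = i -> summand_proj E i B`_l = B`_l.
  move=> li; apply: daddv_pi_id => //; rewrite nthB -[l]tagnat.sig2K.
  by rewrite -li; apply: BE.
have proj_out (l : 'I_(\sum_(i < r) d i)) :
    tagnat.sig1 l != i -> summand_proj E i B`_l = 0.
  move=> li; have xE : B`_l \in (\sum_(j < r | j != i) E j)%VS.
    rewrite nthB -[l]tagnat.sig2K.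
    by apply: subvP (BE _ _); apply: (sumv_sup (tagnat.sig1 l)).
  have disj' : ((\sum_(j < r | j != i) E j) :&: E i = 0)%VS by rewrite capvC.
  (* The two complementary projections of this vector add up to it, and the one onto the other
     summands already returns it. *)
  have := daddv_pi_add disj (subvP (addvSr _ _) _ xE).
  by rewrite (daddv_pi_id disj' xE) => /(canRL (addrK _)); rewrite subrr.
have : tagnat.sig1 (tagnat.Rank i k) = i by rewrite tagnat.Rank1K.
move: (tagnat.Rank i k) => s si.
(* Expanding the projected [w] in [B], only the term at [s] survives: freeness removes the rest of
   block [i], the projection removes the other blocks. *)
rewrite {2}(coord_basis bB (memvf w)) !linear_sum /= (bigD1 s) //=.
rewrite [X in _ = _ + X]big1 => [|l ls].
  by rewrite addr0 !linearZ /= proj_in // coord_free // eqxx mulr1.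
rewrite !linearZ /=; have [li|li] := eqVneq (tagnat.sig1 l) i.
  by rewrite proj_in // coord_free // (negbTE ls) mulr0.
by rewrite proj_out // linear0 mulr0.
Qed.

Theorem theorem23 (F : closedFieldType) (im : F) (him : im ^+ 2 = -1)
    (A : vectType F) (mul : {bilinear A -> A -> A})
    (hA : evolution_algebra mul) (hnd : nondegenerate_algebra mul)
    (r : nat) (D : 'I_r -> model) (hD : Delta_trace im mul D) :
  exists B : (\sum_(i < r) mdim (D i)).-tuple A,
    [/\ natural_basis mul B,
        forall i : 'I_r,
          submxblock (structure_mx mul B) i i =
          structure_mx (@model_mul F im (D i)) (std_basis F (mdim (D i)))
      & exists v : 'I_r -> 'cV[F]_(\sum_(i < r) mdim (D i)),
          forall (i : 'I_r) (j : 'I_(mdim (D i))),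
            col j (submxrow (structure_mx mul B) i) = v i].
Proof.
have [E [[[dirE sumE] extE dimE orthE] dimD isoD _]] := hD.
have [e eP] := fin_all_exists (fun i => summand_square_basis hnd (extE i)
  (dimE i) (dimD i).1 (isoD i)).
have [w wP] := fin_all_exists eP.
pose B :=
  [tuple e (tagnat.sig1 l) (tagnat.sig2 l) | l < \sum_(i < r) mdim (D i)].
have BR i (j : 'I_(mdim (D i))) : tnth B (tagnat.Rank i j) = e i j.
  by rewrite tnth_mktuple /tagnat.sig2 /tagnat.sig1 /tagnat.Rank tagnat.rankK.
(* [B] spans every [E i], and its length is the sum of their dimensions. *)
have bB : basis_of {:A} B.
  rewrite basisEdim size_tuple -sumE (directvP dirE) /=.
  apply/andP; split; last first.
    by apply/eq_leq/eq_bigr => i _; exact: (dimD i).1.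
  apply/subv_sumP => i _; have [_ /subv_trans -> //] := wP i.
  apply/span_subvP => _ /codomP[j ->]; rewrite -BR memv_span ?mem_tnth //.
have BE i (j : 'I_(mdim (D i))) : tnth B (tagnat.Rank i j) \in E i.
  by rewrite BR; have [] := wP i.
have orth i j x y : i != j -> x \in E i -> y \in E j -> mul x y = 0.
  move=> ij xE yE; apply/eqP; rewrite -memv0.
  have /prodsp_subP : (prodsp mul (E i) (E j) <= 0)%VS.
    by rewrite (orthE _ _ ij).1.
  exact.
have coord_e i (j k : 'I_(mdim (D i))) :
    coord B (tagnat.Rank i k) (e i j) = (j == k)%:R.
  rewrite -BR (tnth_nth 0) coord_free ?(basis_free bB) //.
  by rewrite -val_eqE tagnat.eq_Rank eqxx.
have coord_w i (k : 'I_(mdim (D i))) :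
    coord B (tagnat.Rank i k) (w i) = model_sq im (D i) k 0.
  rewrite (coord_summand_proj _ _ dirE bB BE); have [_ _ _ ->] := wP i.
  rewrite linear_sum (bigD1 k) //= [X in _ + X]big1 => [|j /negbTE jk].
    by rewrite linearZ /= coord_e eqxx mulr1 addr0.
  by rewrite linearZ /= coord_e jk mulr0.
(* Every column of block [i] is thus the coordinate vector of [w i]. *)
have sqB i (j : 'I_(mdim (D i))) :
    mul (tnth B (tagnat.Rank i j)) (tnth B (tagnat.Rank i j)) = w i.
  by rewrite BR; have [_ _ -> _] := wP i; rewrite eqxx scale1r.
exists B; split.
- split=> // _ _ /tnthP[l ->] /tnthP[m ->].
  rewrite -[l]tagnat.sig2K -[m]tagnat.sig2K !BR.
  move: (tagnat.sig1 l) (tagnat.sig2 l) (tagnat.sig1 m) (tagnat.sig2 m).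
  move=> i j i' j' neq; have [ii'|ii'] := eqVneq i i'; last first.
    by apply: (orth _ _ _ _ ii'); rewrite -BR.
  (* Identifying the blocks gives [j] and [j'] the same type, so that they can be compared. *)
  case: _ / ii' in j' neq *; have [_ _ -> _] := wP i.
  have [jj'|_] := eqVneq j j'; last by rewrite scale0r.
  by rewrite jj' eqxx in neq.
- move=> i; rewrite structure_mx_model; apply/matrixP => k j.
  by rewrite !mxE sqB coord_w.
- exists (fun i => \col_k coord B k (w i)) => i j.
  by apply/colP => k; rewrite !mxE sqB.
Qed.
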